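(* Let $\hat{\mathcal{M}}\subset GL(2,\mathbb{Z})$ be the $1/2$-monoid, $\mathcal{M}_T$ the set of matrices of type T, and $\mathcal{M}_S$ the set of those matrices of type S which are associated to rationals whose nearest integer continued fraction ends with the couple $(2,+1)$. Then $$\hat{\mathcal{M}}=\mathcal{M}_T\cup\mathcal{M}_S .$$
   Context: $GL(2,\mathbb{Z})$ is the group of $2\times 2$ integer matrices of determinant $\pm1$; $1$ also denotes the identity matrix. The $1/2$-monoid. For an integer $m\geq 1$ let $g(m)=\begin{pmatrix} 0 & 1 \\ 1 & m \end{pmatrix}$, and let $\sigma=\begin{pmatrix} -1 & 1 \\ 0 & 1 \end{pmatrix}$. Set $\hat{\mathcal{M}}^{(0)}=\{1\}$ and, for $r\geq 1$, let $\hat{\mathcal{M}}^{(r)}$ be the set of $g\in GL(2,\mathbb{Z})$ for which there exist $\epsilon_0,\dots,\epsilon_{r-1}\in\{1,\sigma\}$ and integers $m_1,\dots,m_r\geq 2$ with $g=\epsilon_0 g(m_1)\epsilon_1 g(m_2)\cdots\epsilon_{r-1}g(m_r)$. Then $\hat{\mathcal{M}}=\bigcup_{r\geq 0}\hat{\mathcal{M}}^{(r)}$. Nearest integer continued fraction. For $x\in\mathbb{R}$ let $\|x\|$ be the integer nearest to $x$, half-integers being rounded down. Put $a_0=\|x\|$, $x_0=|x-a_0|$, $\varepsilon_0=+1$ if $x\geq a_0$ and $\varepsilon_0=-1$ otherwise; and, as long as $x_n\neq 0$, $a_{n+1}=\|x_n^{-1}\|$, $x_{n+1}=|x_n^{-1}-a_{n+1}|$,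 $\varepsilon_{n+1}=+1$ if $x_n^{-1}\geq a_{n+1}$ and $\varepsilon_{n+1}=-1$ otherwise. For rational $x$ the algorithm stops at some $\bar n$ with $x_{\bar n}=0$ (so $\varepsilon_{\bar n}=+1$), and one writes $x=[(a_0,\varepsilon_0),\dots,(a_{\bar n},\varepsilon_{\bar n})]$. In general $[(a_0,\varepsilon_0),\dots,(a_n,\varepsilon_n)]$ denotes the number $a_0+\varepsilon_0/(a_1+\varepsilon_1/(a_2+\cdots+\varepsilon_{n-1}/a_n))$ (the last sign $\varepsilon_n$ plays no role in the value). With this convention, if $\bar n\ge 1$ and $a_{\bar n}=2$ then $\varepsilon_{\bar n-1}=+1$. Type T and type S matrices. Let $p/q\in[0,1)$ be in lowest terms ($q>0$) with nearest integer continued fraction $[(a_0,\varepsilon_0),\dots,(a_{\bar n},\varepsilon_{\bar n})]$, $\bar n\geq 1$. Define, in lowest terms with positive denominators, $p_T/q_T=[(a_0,\varepsilon_0),\dots,(a_{\bar n-1},\varepsilon_{\bar n-1})]$ and $p_S/q_S=[(a_0,\varepsilon_0),\dots,(a_{\bar n-1},\varepsilon_{\bar n-1}),(a_{\bar n}-1,\varepsilon_{\bar n})]$. The matrix of type T associated to $p/q$ is $g_T=\begin{pmatrix} p_T & p \\ q_T & q \end{pmatrix}$ and the matrix of type S is $g_S=\begin{pmatrix} p_S & p \\ q_S & q \end{pmatrix}$. By convention the identity matrix (which corresponds to $p/q=0/1$, $\bar n=0$) is also counted as a matrix of type T. $\mathcal{M}_T$ is the set of all matrices of type T, and $\mathcal{M}_S$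 is the set of all matrices $g_S$ associated to those $p/q$ with $(a_{\bar n},\varepsilon_{\bar n})=(2,+1)$. *)

(* Defs.v *)
From HB Require Import structures.
From mathcomp Require Import all_boot all_order all_algebra.
From mathcomp Require Import boolp classical_sets.

Set Implicit Arguments.
Unset Strict Implicit.
Unset Printing Implicit Defensive.

Import Order.TTheory GRing.Theory Num.Theory.
Local Open Scope classical_set_scope.
Local Open Scope ring_scope.

Definition mx2 (a b c d : int) : 'M[int]_2 :=
  \matrix_(i, j) if i == 0 then (if j == 0 then a else b)
                 else (if j == 0 then c else d).

(* MathComp's {'GL_2[R]} needs R finite, so GL(2,Z) is a set of matrices. *)
Definition GL2Z : set 'M[int]_2 := [set g | \det g = 1 \/ \det g = -1].

Definition gmx (m : int) : 'M[int]_2 := mx2 0 1 1 m.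

Definition sigma : 'M[int]_2 := mx2 (-1) 1 0 1.

(* The i-th factor is eps_i g(m_(i+1)), i.e. m i stands for m_(i+1).  For r = 0
   the product is empty and the set is {1}. *)
Definition Mhat_ (r : nat) : set 'M[int]_2 :=
  [set g | GL2Z g /\
    exists (eps : 'I_r -> 'M[int]_2) (m : 'I_r -> int),
      [/\ forall i, eps i = 1 \/ eps i = sigma,
          forall i, 2 <= m i
        & g = \prod_(i < r) (eps i * gmx (m i))]].

Definition Mhat : set 'M[int]_2 := \bigcup_r Mhat_ r.

Definition nint (R : archiRealFieldType) (x : R) : int := Num.ceil (x - 2^-1).

Lemma nint_itv (R : archiRealFieldType) (x : R) :
  - 2^-1 < x - (nint x)%:~R <= 2^-1.
Proof.
have /andP[] := ceil_itv (x - 2^-1); rewrite -/(nint x) rmorphB /= => h1 h2.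
rewrite lerBlDr -lerBlDl h2 andbT ltrBrDr addrC -ltrBrDr opprK.
by move: h1; rewrite ltrBlDr -addrA [X in _ + X](_ : _ = 2^-1) //
  [X in _ + X](splitr 1) div1r addrA addNr add0r.
Qed.

(* nicf_arg x n is the number whose nearest integer is a_n: it is x for n = 0
   and x_(n-1)^-1 for n > 0.  Since 0^-1 = 0, the sequences below are total;
   they are only meaningful up to the first n with x_n = 0. *)
Fixpoint nicf_arg (R : archiRealFieldType) (x : R) (n : nat) : R :=
  if n is n'.+1 then
    let y := nicf_arg x n' in `|y - (nint y)%:~R|^-1
  else x.

Definition nicf_a (R : archiRealFieldType) (x : R) (n : nat) : int :=
  nint (nicf_arg x n).

Definition nicf_rem (R : archiRealFieldType) (x : R) (n : nat) : R :=
  `|nicf_arg x n - (nicf_a x n)%:~R|.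

Definition nicf_eps (R : archiRealFieldType) (x : R) (n : nat) : int :=
  if (nicf_a x n)%:~R <= nicf_arg x n then 1 else -1.

(* [:: (a_0, eps_0); ...; (a_(n-1), eps_(n-1))] *)
Definition nicf_couples (R : archiRealFieldType) (x : R) (n : nat) :
    seq (int * int) :=
  mkseq (fun k => (nicf_a x k, nicf_eps x k)) n.

(* The expansion of x is nicf_couples x N.+1. *)
Definition nicf_stops (R : archiRealFieldType) (x : R) (N : nat) : Prop :=
  nicf_rem x N = 0 /\ forall n, (n < N)%N -> nicf_rem x n != 0.

Fixpoint cf_val (s : seq (int * int)) : rat :=
  match s with
  | [::] => 0
  | [:: (a, _)] => a%:~R
  | (a, e) :: t => a%:~R + e%:~R / cf_val t
  end.

Definition cols_mx (y x : rat) : 'M[int]_2 :=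
  mx2 (numq y) (numq x) (denq y) (denq x).

(* gT x N and gS x N are the matrices of type T and S associated to x when the
   expansion of x stops at N. *)
Definition gT (x : rat) (N : nat) : 'M[int]_2 :=
  cols_mx (cf_val (nicf_couples x N)) x.

Definition gS (x : rat) (N : nat) : 'M[int]_2 :=
  cols_mx
    (cf_val (rcons (nicf_couples x N) (nicf_a x N - 1, nicf_eps x N))) x.

Definition MT : set 'M[int]_2 :=
  [set g | g = 1 \/
    exists (x : rat) (N : nat),
      [/\ 0 <= x < 1, nicf_stops x N, (1 <= N)%N & g = gT x N]].

Definition MS : set 'M[int]_2 :=
  [set g | exists (x : rat) (N : nat),
      [/\ 0 <= x < 1, nicf_stops x N, (1 <= N)%N,
          (nicf_a x N, nicf_eps x N) = (2, 1) & g = gS x N]].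

(* Main.v *)
Require Import Defs.
From mathcomp Require Import all_boot all_order all_algebra.
From mathcomp Require Import boolp classical_sets.
From mathcomp Require Import ring lra zify.
Local Open Scope classical_set_scope.

(** A matrix g of the half-monoid is determined by its columns, that is, by the
rationals g(oo) and g(0), where g acts by homographies: g(m) is x |-> 1/(m + x)
and sigma is x |-> 1 - x.  Multiplying a matrix on the left by eps * g(m)
therefore applies to both columns the map step y = eps(1/(m + y)).

On the side of continued fractions, let y lie in [0,1), let m >= 2 and set
x = step y.  Then 1/(m + y) is at most 1/2, hence is the distance from x to its
nearest integer.  Unless it equals 1/2 with eps = sigma, the algorithm run on x
first outputs (0,+1) or (1,-1), according to eps, and continues as it does on
m + y, hence as on y up to the addition of m to the first partial quotient.  The
truncated expansions of x are then the images by step of those of y, so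
g_T(x) = eps g(m) g_T(y) and g_S(x) = eps g(m) g_S(y) for y > 0, while
g_T(x) = eps g(m) for y = 0.  Conversely, every x in [0,1) other than 0 is step y
for some such eps, m and y, with m the integer part of the inverse of the
distance from x to its nearest integer.  Both inclusions follow by induction, on
the length of the product or of the expansion.

The exception comes from half-integers being rounded down; it forces m = 2 and
y = 0.  So it only concerns the last factor of a product, which is then
sigma * g(2), and this matrix is exactly g_S(1/2) (lemma gS_half).  The products
that end with it give the matrices of type S whose expansion ends with (2,+1);
all other products are of type T.  The main
lemmas are cols_mx_step for the matrices, nicf_trunc_step for the expansions,
step_decomp for the decomposition of x, and MTUMS_step for the stability of the
right-hand side under left multiplication by eps * g(m). *)

(** * The half-monoid as generated by left multiplications *)

Section HalfMonoid.

Import Order.TTheory GRing.Theory Num.Theory.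
Local Open Scope ring_scope.
Implicit Types (b : bool) (m : int) (x y w z : rat) (N : nat).

Definition epsmx b : 'M[int]_2 := if b then sigma else 1.

Lemma mul_mx2 (a b c d a' b' c' d' : int) :
  mx2 a b c d * mx2 a' b' c' d' =
  mx2 (a * a' + b * c') (a * b' + b * d') (c * a' + d * c') (c * b' + d * d').
Proof.
apply/matrixP=> i j; rewrite !mxE !big_ord_recl big_ord0 !mxE /= addr0.
by case: i => [[|[|//]] ?]; case: j => [[|[|//]] ?].
Qed.

Lemma det_mx2 (a b c d : int) : \det (mx2 a b c d) = a * d - b * c.
Proof.
rewrite (expand_det_row _ ord0) !big_ord_recl big_ord0 /cofactor !det_mx11 !mxE /=.
by rewrite expr0 expr1; ring.
Qed.

Lemma Mhat1 : Mhat 1.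
Proof.
exists 0%N => //; split; first by left; rewrite det1.
exists (fun=> 1), (fun=> 2).
by split; [left | | rewrite big_ord0].
Qed.

Lemma GL2ZM g h : GL2Z g -> GL2Z h -> GL2Z (g * h).
Proof.
by rewrite /GL2Z /= detM => -[->|->] [->|->];
  rewrite ?mulr1 ?mul1r ?mulrNN ?mulr1; [left|right|right|left].
Qed.

Lemma GL2Z_eps_gmx b m : GL2Z (epsmx b * gmx m).
Proof.
apply: GL2ZM; last by right; rewrite det_mx2; ring.
by case: b; [right; rewrite det_mx2; ring | left; rewrite det1].
Qed.

Lemma MhatM b m h : 2 <= m -> Mhat h -> Mhat (epsmx b * gmx m * h).
Proof.
move=> m2 [r _ [hGL [eps [ms [heps hms hE]]]]].
exists r.+1 => //; split; first exact: GL2ZM (GL2Z_eps_gmx b m) hGL.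
exists (fun i => if unlift ord0 i is Some j then eps j else epsmx b).
exists (fun i => if unlift ord0 i is Some j then ms j else m).
split=> [i|i|].
- by case: unliftP => // _; case: (b); [right | left].
- by case: unliftP.
- rewrite big_ord_recl unlift_none hE; congr (_ * _).
  by apply: eq_bigr => i _; rewrite liftK.
Qed.

Lemma Mhat_ind (P : 'M[int]_2 -> Prop) :
    P 1 -> (forall b m h, 2 <= m -> P h -> P (epsmx b * gmx m * h)) ->
  forall g, Mhat g -> P g.
Proof.
move=> P1 PM g [r _ [_ [eps [ms [heps hms ->]]]]].
elim: r eps ms heps hms => [|r IH] eps ms heps hms; first by rewrite big_ord0.
rewrite big_ord_recl.
have [b ->] : exists b, eps ord0 = epsmx b.
  by case: (heps ord0) => ->; [exists false | exists true].
by apply: PM => //; apply: IH.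
Qed.

(** * Homographies on the columns *)

(** Action of epsmx b as a homography. *)
Definition eps_act b x : rat := if b then 1 - x else x.

(** Action of epsmx b * gmx m as a homography. *)
Definition step b m y : rat := eps_act b (m%:~R + y)^-1.

Lemma numden_eq z (n d : int) :
  0 < d -> coprime `|n| `|d| -> z * d%:~R = n%:~R -> numq z = n /\ denq z = d.
Proof.
move=> d0 cnd zE.
have -> : z = n%:~R / d%:~R by rewrite -zE mulfK // intr_eq0 gt_eqF.
by rewrite coprimeq_num // coprimeq_den // gtr0_sg // mul1r gt_eqF // gtr0_norm.
Qed.

(** Integral translations and inversion keep fractions in lowest terms, since they
are given by matrices of GL(2,Z); only the sign of the denominator has to be
watched, whence the positivity hypothesis of numden_inv. *)
Lemma numden_shift m w :
  numq (m%:~R + w) = m * denq w + numq w /\ denq (m%:~R + w) = denq w.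
Proof.
apply: numden_eq => //; last by rewrite mulrDl intrD intrM numqE.
have := coprime_num_den w; rewrite -!coprimezE.
by rewrite /coprimez ![gcdz _ (denq w)]gcdzC gcdzMDl.
Qed.

Lemma numden_inv z : 0 < z -> numq z^-1 = denq z /\ denq z^-1 = numq z.
Proof.
move=> z0; apply: numden_eq; first by rewrite numq_gt0.
  by rewrite coprime_sym coprime_num_den.
by rewrite numqE mulKf // gt_eqF.
Qed.

Lemma cols_mx_eps_act b w y :
  cols_mx (eps_act b w) (eps_act b y) = epsmx b * cols_mx w y.
Proof.
case: b; last by rewrite mul1r.
rewrite /cols_mx /sigma mul_mx2 /=.
have shift1 z : numq (1 - z) = denq z - numq z /\ denq (1 - z) = denq z.
  by have := numden_shift 1 (- z); rewrite numqN denqN mul1r.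
have [-> ->] := shift1 w; have [-> ->] := shift1 y.
by congr mx2; ring.
Qed.

(** Left multiplication by eps * g(m) acts columnwise through the homography.  The
positivity of m + w and m + y makes the denominators positive without a change
of sign, so the identity holds between matrices and not only up to signs. *)
Lemma cols_mx_step b m w y : 0 < m%:~R + w -> 0 < m%:~R + y ->
  cols_mx (step b m w) (step b m y) = epsmx b * gmx m * cols_mx w y.
Proof.
move=> w0 y0; rewrite cols_mx_eps_act -mulrA; congr (_ * _).
rewrite /cols_mx /gmx mul_mx2.
have [-> ->] := numden_inv _ w0; have [-> ->] := numden_inv _ y0.
have [-> ->] := numden_shift m w; have [-> ->] := numden_shift m y.
by congr mx2; ring.
Qed.

(** * The nearest integer algorithm along a step *)

Lemma nint_eq x (k : int) : - 2^-1 < x - k%:~R <= 2^-1 -> nint x = k.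
Proof. by move=> h; apply: ceil_def; rewrite intrD /=; lra. Qed.

Lemma nint_shift m y : nint (m%:~R + y) = m + nint y.
Proof. by apply: nint_eq; rewrite intrD; have := nint_itv y; lra. Qed.

Lemma nicf_arg_tail x N : nicf_arg x N.+1 = nicf_arg (nicf_rem x 0)^-1 N.
Proof. by elim: N => // N IH; rewrite [LHS]/= -/(nicf_arg x N.+1) IH. Qed.

Lemma nicf_arg_shift m y N :
  nicf_arg (m%:~R + y) N = (if N == 0%N then m%:~R else 0) + nicf_arg y N.
Proof.
case: N => // N; rewrite add0r.
rewrite !nicf_arg_tail; congr nicf_arg; congr _^-1.
by rewrite /nicf_rem /nicf_a /= nint_shift intrD opprD addrACA subrr add0r.
Qed.

(** Conditions under which the algorithm undoes step b m y.  For b = true the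
bound is strict: at m + y = 2 one has step b m y = 1/2, which is rounded down to
0 and not up to 1. *)
Definition admissible b m y : Prop :=
  [/\ 2 <= m, 0 <= y < 1 & b -> 2 < m%:~R + y].

Lemma admissible_ge2 b m y : admissible b m y -> 2 <= m%:~R + y.
Proof.
case=> m2 y01 _; have : (2%:~R : rat) <= m%:~R by rewrite ler_int.
by move: y01; lra.
Qed.

Lemma admissible_inv b m y : admissible b m y ->
  [/\ 0 < (m%:~R + y)^-1, (m%:~R + y)^-1 <= 2^-1
    & b -> (m%:~R + y)^-1 < 2^-1].
Proof.
move=> adm; have z2 := admissible_ge2 _ _ _ adm; case: adm => _ _ hb.
split=> [||/hb ?].
- by rewrite invr_gt0; lra.
- by rewrite lef_pV2 // posrE; lra.
- by rewrite ltf_pV2 // posrE; lra.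
Qed.

Lemma step_itv b m y : admissible b m y -> 0 <= step b m y < 1.
Proof. by move=> /admissible_inv[]; rewrite /step; case: b => /= *; lra. Qed.

Lemma step_a0 b m y : admissible b m y -> nicf_a (step b m y) 0 = (b : nat)%:Z.
Proof.
move=> /admissible_inv[]; rewrite /nicf_a /step => h1 h2 h3.
apply: nint_eq; case: b h3 => /= h3; last by lra.
by have := h3 isT; lra.
Qed.

Lemma step_eps0 b m y :
  admissible b m y -> nicf_eps (step b m y) 0 = if b then -1 else 1.
Proof.
move=> adm; rewrite /nicf_eps step_a0 //.
case: (admissible_inv _ _ _ adm) => h1 _ _; rewrite /step /=.
by case: (b) => /=; case: lerP => // ?; exfalso; lra.
Qed.

Lemma step_rem0 b m y :
  admissible b m y -> nicf_rem (step b m y) 0 = (m%:~R + y)^-1.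
Proof.
move=> adm; rewrite /nicf_rem step_a0 //.
case: (admissible_inv _ _ _ adm) => h1 _ _; rewrite /step /=.
case: (b) => /=; last by rewrite subr0 gtr0_norm.
by rewrite addrAC subrr add0r normrN gtr0_norm.
Qed.

Lemma step_arg b m y N : admissible b m y ->
  nicf_arg (step b m y) N.+1 =
  (if N == 0%N then m%:~R else 0) + nicf_arg y N.
Proof. by move=> adm; rewrite nicf_arg_tail step_rem0 // invrK nicf_arg_shift. Qed.

Lemma step_a b m y N : admissible b m y ->
  nicf_a (step b m y) N.+1 = (if N == 0%N then m else 0) + nicf_a y N.
Proof.
move=> adm; rewrite /nicf_a step_arg //.
by case: eqP => _; rewrite ?nint_shift // !add0r.
Qed.

Lemma step_eps b m y N : admissible b m y ->
  nicf_eps (step b m y) N.+1 = nicf_eps y N.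
Proof.
move=> adm; rewrite /nicf_eps step_a // step_arg //.
by case: eqP => _; rewrite ?add0r // intrD lerD2l.
Qed.

Lemma step_rem b m y N : admissible b m y ->
  nicf_rem (step b m y) N.+1 = nicf_rem y N.
Proof.
move=> adm; rewrite /nicf_rem step_a // step_arg //.
by case: eqP => _; rewrite ?add0r // intrD opprD addrACA subrr add0r.
Qed.

Lemma step_stops b m y N : admissible b m y ->
  nicf_stops (step b m y) N.+1 <-> nicf_stops y N.
Proof.
move=> adm; split=> -[r0 rn]; split.
- by rewrite -r0 step_rem.
- by move=> n nN; have := rn n.+1 nN; rewrite step_rem.
- by rewrite step_rem.
- case=> [_|n nN]; last by rewrite step_rem //; apply: rn.
  by rewrite step_rem0 // gt_eqF //; case: (admissible_inv _ _ _ adm).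
Qed.

(** The sign records on which side of 1/2 the number x lies, and m + y is the
decomposition of the inverse remainder into integer and fractional parts. *)
Lemma step_decomp x : 0 <= x < 1 -> nicf_rem x 0 != 0 ->
  exists b m y, admissible b m y /\ x = step b m y.
Proof.
move=> x01 r0; pose u := nicf_rem x 0; pose b := 2^-1 < x.
have xE : x = eps_act b u.
  rewrite /u /nicf_rem /nicf_a /b /=; case: ltP => hx.
    by rewrite (nint_eq _ 1) /= ?ltr0_norm; lra.
  by rewrite (nint_eq _ 0) /= ?subr0 ?ger0_norm; lra.
have u0 : 0 < u by rewrite lt0r r0 normr_ge0.
have u2 : u <= 2^-1.
  by rewrite /u /nicf_rem ler_norml; have := nint_itv x; rewrite -/(nicf_a x 0) /=; lra.
have z2 : 2 <= u^-1 by rewrite -[2]invrK lef_pV2 // posrE; lra.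
have /andP[f1 f2] := floor_itv u^-1.
exists b, (Num.floor u^-1), (u^-1 - (Num.floor u^-1)%:~R).
rewrite /step subrKC invrK; split=> //; split.
- by rewrite floor_ge_int.
- by move: f1 f2; rewrite intrD; lra.
- move=> hb; rewrite subrKC -[2]invrK ltf_pV2 ?posrE //.
  by move: xE; rewrite /eps_act hb; move: hb; rewrite /b; lra.
Qed.

Lemma stops0 x : 0 <= x < 1 -> nicf_stops x 0 -> x = 0.
Proof.
move=> x01 [/eqP]; rewrite normr_eq0 subr_eq0 => /eqP /= xE _.
move: x01; rewrite xE ler0z ltrz1 => /andP[? ?].
by rewrite (_ : nicf_a x 0 = 0) //; lia.
Qed.

(** * Truncated expansions *)

(** The first N.+1 couples with the last partial quotient lowered by d: d = 0 gives
the first column of type T at rank N.+1, and d = 1 the one of type S at rank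
N. *)
Definition nicf_trunc x N (d : int) : rat :=
  cf_val (rcons (nicf_couples x N) (nicf_a x N - d, nicf_eps x N)).

Lemma gT_trunc x N : gT x N.+1 = cols_mx (nicf_trunc x N 0) x.
Proof. by rewrite /gT /nicf_trunc subr0 /nicf_couples mkseqS. Qed.

Lemma cf_val_cons a e t : t != [::] ->
  cf_val ((a, e) :: t) = a%:~R + e%:~R / cf_val t.
Proof. by case: t. Qed.

Lemma cf_val_shift m a e t :
  cf_val ((m + a, e) :: t) = m%:~R + cf_val ((a, e) :: t).
Proof.
by case: t => [|c t]; [rewrite /= intrD | rewrite !cf_val_cons // intrD addrA].
Qed.

Lemma mkseqSl (T : Type) (f : nat -> T) n :
  mkseq f n.+1 = f 0%N :: mkseq (fun k => f k.+1) n.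
Proof. by rewrite /mkseq /= -[1%N]addn0 iotaDl -map_comp. Qed.

(** Truncation commutes with step: the head of the expansion of step b m y is
(0,+1) or (1,-1), which contributes eps_act b, and its tail is the expansion of y
with m added to the first partial quotient. *)
Lemma nicf_trunc_step b m y N d : admissible b m y ->
  nicf_trunc (step b m y) N.+1 d = step b m (nicf_trunc y N d).
Proof.
move=> adm; rewrite {1}/nicf_trunc /nicf_couples mkseqSl rcons_cons cf_val_cons; last first.
  by case: (mkseq _ _).
rewrite step_a0 // step_eps0 //.
set t := cf_val _.
have -> : t = m%:~R + nicf_trunc y N d.
  rewrite /t /nicf_trunc /nicf_couples step_a // step_eps //; case: N {t} => [|N].
    by rewrite /= -addrA [in LHS]intrD.
  rewrite -[N.+1 == 0%N]/false add0r !mkseqSl !rcons_cons -cf_val_shift step_a // step_eps //.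
  congr (cf_val (_ :: rcons _ _)).
  by apply: eq_mkseq => k; rewrite step_a // step_eps //= add0r.
by rewrite /step /eps_act; case: (b) => /=; rewrite ?mulN1r ?mul1r ?add0r.
Qed.

(** For N = 0 and d = 1 the value is -1 when the first partial quotient is 0, so
the lower bound is not 0; since m >= 2, the bound -1 is enough to keep
m + nicf_trunc y N d positive, as cols_mx_step demands, and to propagate. *)
Lemma nicf_trunc_geN1 x N d : d <= 1 -> 0 <= x < 1 ->
  (forall n, (n < N)%N -> nicf_rem x n != 0) -> -1 <= nicf_trunc x N d.
Proof.
move=> d1; elim: N x => [|N IH] x x01 hx.
  rewrite /nicf_trunc /= (_ : -1 = (-1)%:~R) // ler_int.
  suff : 0 <= nicf_a x 0 by lia.
  by rewrite /nicf_a /nint ceil_ge0 /=; lra.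
have [b [m [y [adm xE]]]] := step_decomp _ x01 (hx 0%N isT).
rewrite xE nicf_trunc_step //.
have w1 : -1 <= nicf_trunc y N d.
  apply: IH; first by case: adm.
  by move=> n nN; have := hx n.+1 nN; rewrite xE step_rem.
have m2 : (2 : rat) <= m%:~R by case: adm => m2 _ _; rewrite (ler_int _ 2).
rewrite /step; set z := m%:~R + _.
have z1 : 1 <= z by rewrite /z; lra.
have : 0 < z^-1 by rewrite invr_gt0; lra.
have : z^-1 <= 1 by rewrite invf_le1 //; lra.
by rewrite /eps_act; case: (b); lra.
Qed.

Lemma cols_mx_trunc_step b m y N d : d <= 1 -> admissible b m y ->
    (forall n, (n < N)%N -> nicf_rem y n != 0) ->
  cols_mx (nicf_trunc (step b m y) N.+1 d) (step b m y) =
  epsmx b * gmx m * cols_mx (nicf_trunc y N d) y.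
Proof.
move=> d1 adm hy; have z2 := admissible_ge2 _ _ _ adm.
rewrite nicf_trunc_step // cols_mx_step //; last by lra.
case: adm => m2 y01 _; have := nicf_trunc_geN1 _ _ _ d1 y01 hy.
have : (2 : rat) <= m%:~R by rewrite (ler_int _ 2).
by lra.
Qed.

(** * The matrices of types T and S *)

Lemma gT_step b m y N : admissible b m y -> nicf_stops y N.+1 ->
  gT (step b m y) N.+2 = epsmx b * gmx m * gT y N.+1.
Proof.
move=> adm [_ yn]; rewrite !gT_trunc cols_mx_trunc_step // => n nN.
by apply: yn; apply: leqW.
Qed.

(** N = 0 is allowed here: lowering the only partial quotient of 0 gives
-1, so gS 0 0 has first column (-1, 1), which makes gS_half an instance of the same recursion. *)
Lemma gS_step b m y N : admissible b m y -> nicf_stops y N ->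
  gS (step b m y) N.+1 = epsmx b * gmx m * gS y N.
Proof. by move=> adm [_ yn]; apply: cols_mx_trunc_step. Qed.

Lemma gT_step0 b m : admissible b m 0 -> gT (step b m 0) 1 = epsmx b * gmx m.
Proof.
move=> adm; have z0 : (0 : rat) < m%:~R.
  by have := admissible_ge2 _ _ _ adm; rewrite addr0; lra.
rewrite gT_trunc /nicf_trunc /= step_a0 // subr0.
have -> : ((b : nat)%:Z)%:~R = eps_act b 0 by case: (b).
rewrite /step cols_mx_eps_act addr0; congr (_ * _).
rewrite /cols_mx; have [-> ->] := numden_inv _ z0.
by rewrite numq_int denq_int.
Qed.

Lemma stops00 : nicf_stops (0 : rat) 0.
Proof. by []. Qed.

(** The number 1/2 carries the two products g(2) and sigma * g(2): the first one is
its matrix of type T, the second its matrix of type S. *)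
Lemma gS_half : gS (step false 2 0) 1 = sigma * gmx 2.
Proof.
have adm : admissible false 2 0 by split.
rewrite gS_step //.
rewrite /gS /= /nicf_a /= (nint_eq _ 0) // mul1r.
by rewrite /sigma /gmx /cols_mx !mul_mx2; congr mx2.
Qed.

Lemma gT_Mhat x N : 0 <= x < 1 -> nicf_stops x N.+1 -> Mhat (gT x N.+1).
Proof.
elim: N x => [|N IH] x x01 st;
  have [b [m [y [adm xE]]]] := step_decomp _ x01 (proj2 st 0%N isT);
  have [m2 y01 _] := adm; move: st; rewrite {x x01}xE step_stops // => st.
- have y0 := stops0 _ y01 st; rewrite y0 in adm *.
  by rewrite gT_step0 // -[_ * gmx m]mulr1; apply: MhatM => //; exact: Mhat1.
- by rewrite gT_step //; apply: MhatM => //; apply: IH.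
Qed.

(** The last partial quotient 2 forces the last step to be taken at m = 2 and
y = 0, where admissibility excludes the sign sigma; it is then gS_half that
supplies the last factor sigma * g(2). *)
Lemma gS_Mhat x N : 0 <= x < 1 -> nicf_stops x N.+1 -> nicf_a x N.+1 = 2 ->
  Mhat (gS x N.+1).
Proof.
elim: N x => [|N IH] x x01 st;
  have [b [m [y [adm xE]]]] := step_decomp _ x01 (proj2 st 0%N isT);
  have [m2 y01 hb] := adm; move: st; rewrite {x x01}xE step_stops // => st;
  rewrite step_a //=.
- have y0 := stops0 _ y01 st; rewrite y0 in adm hb *.
  rewrite {1}/nicf_a /= (nint_eq _ 0) // addr0 => mE; rewrite mE in hb *.
  have -> : b = false by apply/negbTE/negP => /hb; rewrite addr0 ltxx.
  rewrite gS_half -[_ * _]mulr1; apply: (MhatM true) => //; exact: Mhat1.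
- by rewrite add0r => a2; rewrite gS_step //; apply: MhatM => //; apply: IH.
Qed.

(** An expansion of positive length has y > 0, hence m + y > 2: the half-integer
exception cannot occur before the last factor of a product. *)
Lemma stopsS_admissible b m y N :
  2 <= m -> 0 <= y < 1 -> nicf_stops y N.+1 -> admissible b m y.
Proof.
move=> m2 y01 [_ /(_ 0%N isT) r0]; split=> // _.
have y0 : y != 0.
  by apply: contraNneq r0 => ->; have [-> _] := stops00.
have : (2 : rat) <= m%:~R by rewrite (ler_int _ 2).
by lra.
Qed.

Lemma MTUMS_step b m h : 2 <= m -> (MT `|` MS) h ->
  (MT `|` MS) (epsmx b * gmx m * h).
Proof.
move=> m2 [[->|[y [[|N] [y01 st // _ ->]]]]|[y [[|N] [y01 st // _ [a2 e1] ->]]]].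
(* For h = 1 the half-integer exception is the factor sigma * g(2). *)
- rewrite mulr1; case: (boolP (b && (m == 2))) => [/andP[-> /eqP ->]|bm].
    have adm : admissible false 2 0 by split.
    right; exists (step false 2 0), 1%N; rewrite gS_half; split=> //.
    by apply/step_stops => //; exact: stops00.
  have adm : admissible b m 0.
    split=> // hb; rewrite addr0 (ltr_int _ 2).
    by move: bm; rewrite hb /=; lia.
  left; right; exists (step b m 0), 1%N; rewrite gT_step0 //; split=> //.
  + exact: step_itv.
  + by apply/step_stops => //; exact: stops00.
- have adm := stopsS_admissible b _ _ _ m2 y01 st.
  left; right; exists (step b m y), N.+2; rewrite gT_step //; split=> //.
  + exact: step_itv.
  + exact/step_stops.
- have adm := stopsS_admissible b _ _ _ m2 y01 st.
  right; exists (step b m y), N.+2; rewrite gS_step //; split=> //.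
  + exact: step_itv.
  + exact/step_stops.
  + by rewrite step_a // step_eps //= add0r a2 e1.
Qed.

End HalfMonoid.

Theorem proposition2p10 : Mhat = MT `|` MS.
Proof.
apply/seteqP; split=> g.
- by apply: Mhat_ind g; [left; left | exact: MTUMS_step].
- case=> [[->|[x [[|N] [x01 st // _ ->]]]]|[x [[|N] [x01 st // _ [a2 _] ->]]]].
  + exact: Mhat1.
  + exact: gT_Mhat.
  + exact: gS_Mhat.
Qed.
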